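(* Consider average cost (AC) pricing, i.e. the SAV fare equals $p = m + F_a/N_a$. Suppose that $$(AN-B)^2-4AF_a\ge 0 .$$ Then multiple mode-choice equilibria exist, and the number of SAV commuters at each equilibrium is $$N_{a0}^{AC*}=0,\qquad N_{a1}^{AC*}=\frac{AN-B-K}{2A},\qquad N_{a2}^{AC*}=\frac{AN-B+K}{2A},$$ where $K=\sqrt{(AN-B)^2-4AF_a}$. If instead $(AN-B)^2-4AF_a<0$, the equilibrium is unique and its number of SAV commuters is $N_{a0}^{AC*}=0$.
   Context: A continuum of commuters of mass $N>0$ splits between normal vehicles (NV, mass $N_n\ge 0$) and shared autonomous vehicles (SAV, mass $N_a\ge0$), $N_n+N_a=N$, all passing a bottleneck of capacity $\mu>0$. Parameters: free-flow time $t_f\ge 0$; NV fixed cost $F_n\ge 0$; SAV waiting cost $w\ge 0$; SAV marginal operating cost $m\ge 0$; SAV fixed operating cost $F_a>0$; schedule-delay penalties $\beta,\gamma>0$; value-of-time parameter $\theta$ with $\beta<\theta<1$; capacity parameter $\kappa$ with $0<\kappa<1$. Given the split and the SAV fare $p$, the mode-specific commuting costs (in departure-time equilibrium) are $$c_n^*(N_n,N_a)=\frac{\beta\gamma}{\mu(\beta+\gamma)}(N_n+\kappa N_a)+t_f+F_n,\qquad c_a^*(N_n,N_a)=\frac{\beta\gamma}{\mu(\beta+\gamma)}(\theta N_n+\kappa N_a)+\theta t_f+p+w .$$ A mode-choice equilibrium is a split $(N_n,N_a)$ with $N_n,N_a\ge0$, $N_n+N_a=N$ such that $c_n^*=c_a^*$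 if $N_n>0$ and $N_a>0$; $c_n^*\le c_a^*$ if $N_a=0$; $c_n^*\ge c_a^*$ if $N_n=0$. Under AC pricing the fare, hence $c_a^*$, is taken to be $+\infty$ at $N_a=0$. Set $$A=\frac{\beta\gamma(1-\theta)}{(\beta+\gamma)\mu},\qquad B=\theta t_f+m+w-(t_f+F_n).$$ Standing assumption: $0<B<AN$. *)

(* Defs.v *)
From HB Require Import structures.
From mathcomp Require Import all_boot all_order all_algebra.
From mathcomp Require Import reals constructive_ereal.

Set Implicit Arguments.
Unset Strict Implicit.
Unset Printing Implicit Defensive.

Import Order.TTheory GRing.Theory Num.Theory.
Local Open Scope ring_scope.

(* Parameters only: the sign conditions are separate, in [admissible]. *)
Record bottleneck (R : realType) := Bottleneck {
  mass : R;                (* N *)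
  capacity : R;            (* mu *)
  free_flow : R;           (* t_f *)
  nv_fixed : R;            (* F_n *)
  sav_wait : R;            (* w *)
  sav_marginal : R;        (* m *)
  sav_fixed : R;           (* F_a *)
  early : R;               (* beta *)
  late : R;                (* gamma *)
  vot : R;                 (* theta *)
  cap_ratio : R            (* kappa *)
}.

Section Model.
Context {R : realType} (M : bottleneck R).

Local Notation N := (mass M).
Local Notation mu := (capacity M).
Local Notation tf := (free_flow M).
Local Notation Fn := (nv_fixed M).
Local Notation w := (sav_wait M).
Local Notation m := (sav_marginal M).
Local Notation Fa := (sav_fixed M).
Local Notation beta := (early M).
Local Notation gamma := (late M).
Local Notation theta := (vot M).
Local Notation kappa := (cap_ratio M).

Record admissible : Prop := Admissible {
  mass_gt0 : 0 < N;
  capacity_gt0 : 0 < mu;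
  free_flow_ge0 : 0 <= tf;
  nv_fixed_ge0 : 0 <= Fn;
  sav_wait_ge0 : 0 <= w;
  sav_marginal_ge0 : 0 <= m;
  sav_fixed_gt0 : 0 < Fa;
  early_gt0 : 0 < beta;
  late_gt0 : 0 < gamma;
  early_lt_vot : beta < theta;
  vot_lt1 : theta < 1;
  cap_ratio_gt0 : 0 < kappa;
  cap_ratio_lt1 : kappa < 1
}.

(* [congestion_gap] is A and [uncongested_gap] is B: for a finite fare p,
   c_n - c_a = A * Nn - B - (p - m). *)
Definition congestion_gap : R := beta * gamma * (1 - theta) / ((beta + gamma) * mu).

Definition uncongested_gap : R := theta * tf + m + w - (tf + Fn).

Definition nv_cost (Nn Na : R) : R :=
  beta * gamma / (mu * (beta + gamma)) * (Nn + kappa * Na) + tf + Fn.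

(* The fare [p] may be [+oo]. *)
Definition sav_cost (p : \bar R) (Nn Na : R) : \bar R :=
  ((beta * gamma / (mu * (beta + gamma)) * (theta * Nn + kappa * Na)
    + theta * tf)%:E + p + w%:E)%E.

(* A pricing scheme sets the SAV fare as a function of the SAV mass [Na]. *)
Definition ac_fare (Na : R) : \bar R :=
  if Na == 0 then +oo%E else (m + Fa / Na)%:E.

(* A split is the pair [(Nn, Na)]. *)
Definition mode_choice_equilibrium (fare : R -> \bar R) (s : R * R) : Prop :=
  let: (Nn, Na) := s in
  let cn := (nv_cost Nn Na)%:E in
  let ca := sav_cost (fare Na) Nn Na in
  [/\ [/\ 0 <= Nn, 0 <= Na & Nn + Na = N],
      0 < Nn -> 0 < Na -> cn = ca,
      Na = 0 -> (cn <= ca)%E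
    & Nn = 0 -> (ca <= cn)%E].

End Model.

(* Main.v *)
Require Import Defs.
From mathcomp Require Import all_boot all_order all_algebra.
From mathcomp Require Import reals constructive_ereal.
From mathcomp Require Import ring lra.
Import Order.TTheory GRing.Theory Num.Theory.
Local Open Scope ring_scope.

(** With the fare [m + Fa / Na], the cost difference [c_n - c_a] at a split with
    [Na > 0] is [A * Nn - B - Fa / Na] ([cost_gapE]).  Since [Nn = N - Na], a
    split is determined by [Na], and two kinds of equilibria can occur.
    - Nobody uses the SAV: the fare is infinite there, so this is always an
      equilibrium, and the only one with [Na = 0] ([equilibrium_no_sav]).
    - Some commuters use the SAV.  Then some also use the NV, because at
      [Nn = 0] the cost difference is [- B - Fa / Na < 0], so that the SAV is
      the dearer mode.  The costs are thus equal, and substituting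
      [Nn = N - Na] and multiplying by [- Na] turns this equality into
      [A * Na ^+ 2 - (A * N - B) * Na + Fa = 0].  Conversely every
      positive root gives an equilibrium, since the equality of the costs reads
      [A * Nn = B + Fa / Na] and so forces [Nn > 0] ([equilibrium_savP]).
    What remains is to solve a quadratic whose discriminant is
    [(A * N - B) ^+ 2 - 4 * A * Fa].  As [4 * A * Fa > 0], its square root [K]
    satisfies [K < A * N - B], so both real roots are positive. *)

(** The real roots of [a * x ^+ 2 - b * x + c], by completing the square. *)
Lemma quadratic_rootP {R : rcfType} {a b c : R} (x : R) :
    a != 0 -> 0 <= b ^+ 2 - 4 * a * c ->
  let K := Num.sqrt (b ^+ 2 - 4 * a * c) in
  a * x ^+ 2 - b * x + c = 0 <->
  x = (b - K) / (2 * a) \/ x = (b + K) / (2 * a).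
Proof.
move=> a0 D0 K; have KE : K ^+ 2 = b ^+ 2 - 4 * a * c by rewrite sqr_sqrtr.
have squareE :
    4 * a * (a * x ^+ 2 - b * x + c) = (2 * a * x - b) ^+ 2 - K ^+ 2.
  by rewrite KE; ring.
have a4 : 4 * a != 0 by rewrite mulf_neq0 ?pnatr_eq0.
have a2 : 2 * a != 0 by rewrite mulf_neq0 ?pnatr_eq0.
split=> [root_x|x_root].
  move/eqP: squareE; rewrite root_x mulr0 eq_sym subr_eq0 eqf_sqr.
  by case/orP=> /eqP hx; [right|left]; apply: (mulfI a2);
    rewrite [RHS]mulrC divfK // -(subrK b (2 * a * x)) hx addrC.
apply: (mulfI a4); rewrite mulr0 squareE.
by case: x_root => ->; rewrite [2 * a * _]mulrC divfK //; ring.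
Qed.

Lemma quadratic_root_discr_ge0 {R : realDomainType} {a b c x : R} :
  a * x ^+ 2 - b * x + c = 0 -> 0 <= b ^+ 2 - 4 * a * c.
Proof.
move=> root_x.
have -> : b ^+ 2 - 4 * a * c =
    (2 * a * x - b) ^+ 2 - 4 * a * (a * x ^+ 2 - b * x + c) by ring.
by rewrite root_x mulr0 subr0 sqr_ge0.
Qed.

Lemma congestion_gap_gt0 {R : realType} {M : bottleneck R} :
  admissible M -> 0 < congestion_gap M.
Proof.
case=> *; by rewrite /congestion_gap divr_gt0 ?mulr_gt0 ?subr_gt0 ?addr_gt0.
Qed.

(** The difference of the NV cost and the SAV cost at a finite fare [p]. *)
Lemma cost_gapE {R : realType} {M : bottleneck R} (p Nn Na : R) :
  admissible M ->
  sav_cost M p%:E Nn Na =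
  (nv_cost M Nn Na - (congestion_gap M * Nn - uncongested_gap M
                      - (p - sav_marginal M)))%:E.
Proof.
case=> *; rewrite /sav_cost -!EFinD; congr (_%:E).
rewrite /nv_cost /congestion_gap /uncongested_gap; field.
by rewrite !gt_eqF ?addr_gt0.
Qed.

(** Without SAV commuters the SAV fare is infinite, so the NV cannot be the
    dearer mode.  Only [0 < mass M] matters: it rules out [Nn = 0]. *)
Lemma equilibrium_no_sav {R : realType} {M : bottleneck R} (Nn : R) :
  0 < mass M ->
  mode_choice_equilibrium M (ac_fare M) (Nn, 0) <-> Nn = mass M.
Proof.
move=> N_gt0; split=> [[[_ _ <-] _ _ _]|->]; first by rewrite addr0.
split; first by rewrite addr0 ltW.
- by rewrite ltxx.
- by rewrite /ac_fare eqxx /sav_cost /= leey.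
- by move=> N0; rewrite N0 ltxx in N_gt0.
Qed.

(** The equilibria with SAV commuters are the positive roots of a quadratic;
    such an equilibrium is interior, because [0 < B]. *)
Lemma equilibrium_savP {R : realType} {M : bottleneck R} {Nn Na : R} :
    admissible M -> 0 < uncongested_gap M -> 0 < Na ->
  mode_choice_equilibrium M (ac_fare M) (Nn, Na) <->
  Nn + Na = mass M /\
  congestion_gap M * Na ^+ 2
    - (congestion_gap M * mass M - uncongested_gap M) * Na + sav_fixed M = 0.
Proof.
move=> hM B_gt0 Na_gt0; have A_gt0 := congestion_gap_gt0 hM.
have Na_neq0 : Na != 0 by rewrite gt_eqF.
have markup_gt0 : 0 < sav_fixed M / Na.
  by rewrite divr_gt0 // sav_fixed_gt0.
rewrite /mode_choice_equilibrium /ac_fare (negPf Na_neq0) cost_gapE //.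
set gap := congestion_gap M * Nn - _ - _.
have gapE : gap = congestion_gap M * Nn - uncongested_gap M - sav_fixed M / Na.
  by rewrite /gap; ring.
have quadE : Nn + Na = mass M ->
    congestion_gap M * Na ^+ 2
      - (congestion_gap M * mass M - uncongested_gap M) * Na + sav_fixed M
    = - Na * gap.
  by move=> <-; rewrite gapE; field.
split=> [[[Nn_ge0 _ sumN] interior _ no_nv]|[sumN root_Na]].
  split=> //; rewrite quadE //.
  have Nn_gt0 : 0 < Nn.
    rewrite lt_neqAle Nn_ge0 andbT eq_sym; apply/eqP => Nn0.
    by move: (no_nv Nn0); rewrite lee_fin gapE Nn0 mulr0; lra.
  have eq_cost := EFin_inj (interior Nn_gt0 Na_gt0).
  have -> : gap = nv_cost M Nn Na - (nv_cost M Nn Na - gap) by rewrite subKr.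
  by rewrite -eq_cost subrr mulr0.
have gap0 : gap = 0.
  move/eqP: root_Na; rewrite quadE // mulf_eq0 oppr_eq0 (negPf Na_neq0).
  by move/eqP.
(* With equal costs, [A * Nn = B + Fa / Na], which is positive. *)
have Nn_gt0 : 0 < Nn by rewrite -(pmulr_rgt0 _ A_gt0); move: gap0; lra.
by rewrite gap0 subr0; split=> //; rewrite !ltW.
Qed.

Theorem proposition2 (R : realType) (M : bottleneck R)
    (hM : admissible M)
    (hB : 0 < uncongested_gap M < congestion_gap M * mass M) :
  let A := congestion_gap M in
  let B := uncongested_gap M in
  let N := mass M in
  let Fa := sav_fixed M in
  let equilibrium := mode_choice_equilibrium M (ac_fare M) in
  let K := Num.sqrt ((A * N - B) ^+ 2 - 4 * A * Fa) in
  (0 <= (A * N - B) ^+ 2 - 4 * A * Fa ->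
     (exists s1 s2 : R * R, [/\ equilibrium s1, equilibrium s2 & s1 <> s2]) /\
     (forall Na : R,
        (exists Nn : R, equilibrium (Nn, Na)) <->
        [\/ Na = 0,
            Na = (A * N - B - K) / (2 * A)
          | Na = (A * N - B + K) / (2 * A)]))
  /\
  ((A * N - B) ^+ 2 - 4 * A * Fa < 0 ->
     (exists! s : R * R, equilibrium s) /\
     (forall s : R * R, equilibrium s -> s.2 = 0)).
Proof.
move=> A B N Fa equilibrium K; case/andP: hB => B_gt0 B_lt.
have A_gt0 : 0 < A := congestion_gap_gt0 hM.
have Fa_gt0 : 0 < Fa := sav_fixed_gt0 hM.
have N_gt0 : 0 < N := mass_gt0 hM.
have AN_gt : 0 < A * N - B by rewrite subr_gt0.
have no_savP Nn : equilibrium (Nn, 0) <-> Nn = N := equilibrium_no_sav Nn N_gt0.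
have savP Nn Na : 0 < Na -> equilibrium (Nn, Na) <->
    Nn + Na = N /\ A * Na ^+ 2 - (A * N - B) * Na + Fa = 0.
  exact: equilibrium_savP.
have Na_cases Nn Na : equilibrium (Nn, Na) -> Na = 0 \/ 0 < Na.
  by case=> -[_]; rewrite le_eqVlt => /orP[/eqP<-|]; [left|right].
clearbody A B N Fa equilibrium; split=> [D_ge0|D_lt0].
  (* [4 * A * Fa > 0] makes both roots positive. *)
  have K_lt : K < A * N - B.
    rewrite -(ltr_pXn2r (n := 2)) ?nnegrE ?sqrtr_ge0 ?(ltW AN_gt) //.
    by rewrite sqr_sqrtr // gtrBl !mulr_gt0.
  have K_ge0 : 0 <= K := sqrtr_ge0 _.
  have root_gt0 Na : Na = (A * N - B - K) / (2 * A)
      \/ Na = (A * N - B + K) / (2 * A) -> 0 < Na.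
    by case=> ->; rewrite divr_gt0 ?mulr_gt0 //; lra.
  have rootP Na := quadratic_rootP Na (lt0r_neq0 A_gt0) D_ge0.
  have equilibrium_root Na : Na = (A * N - B - K) / (2 * A)
      \/ Na = (A * N - B + K) / (2 * A) -> equilibrium (N - Na, Na).
    move=> Na_root; apply/savP; first exact: root_gt0.
    by split; [rewrite subrK | apply/rootP].
  split.
    set x := (A * N - B - K) / (2 * A).
    have x_root : x = x \/ x = (A * N - B + K) / (2 * A) by left.
    exists (N, 0), (N - x, x); split; first exact/no_savP.
      exact: equilibrium_root.
    by case=> _ x0; move: (root_gt0 _ x_root); rewrite -x0 ltxx.
  move=> Na; split=> [[Nn eqN]|].
    case: (Na_cases _ _ eqN) => [|Na_gt0]; first by constructor 1.
    have [_ /rootP[]] := (savP _ _ Na_gt0).1 eqN; first by constructor 2.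
    by constructor 3.
  case=> [->|Na1|Na2]; first by exists N; apply/no_savP.
    by exists (N - Na); apply: equilibrium_root; left.
  by exists (N - Na); apply: equilibrium_root; right.
have Na0 Nn Na : equilibrium (Nn, Na) -> Na = 0.
  move=> eqN; case: (Na_cases _ _ eqN) => // Na_gt0.
  have [_ /quadratic_root_discr_ge0] := (savP _ _ Na_gt0).1 eqN.
  by rewrite leNgt D_lt0.
split; last by case=> Nn Na /Na0.
exists (N, 0); split=> [|[Nn Na] eqN]; first exact/no_savP.
have Na_eq0 := Na0 _ _ eqN.
by move: eqN; rewrite Na_eq0 => /no_savP ->.
Qed.
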